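(* Let $n$ be an integer with $1\le n<\infty$, and let $A=\mathrm{IDD}(K^0_n,1,-1)$ be the complex algebra with basis $e_0,e_1,\ldots,e_n$ and bilinear multiplication $e_i\diamond e_j=\frac{i}{j+1}e_{i+j}$ if $i+j\le n$, and $e_i\diamond e_j=0$ otherwise. Then the space of derivations of $A$ is $$\mathfrak{Der}(A)=\langle\varphi\rangle,\qquad \varphi(e_i)=i\,e_i\quad(0\le i\le n).$$
   Context: A derivation of an algebra $(A,\diamond)$ is a linear map $D:A\to A$ with $D(a\diamond b)=D(a)\diamond b+a\diamond D(b)$ for all $a,b\in A$. $\langle S\rangle$ denotes the linear span of $S$ over $\mathbb C$. *)

(* Defs.v *)
From HB Require Import structures.
From mathcomp Require Import all_boot all_order all_algebra.
From mathcomp Require Import classical_sets reals complex.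
Set Implicit Arguments.
Unset Strict Implicit.
Unset Printing Implicit Defensive.
Import GRing.Theory.
Local Open Scope ring_scope.

(* A (nonassociative, nonunital) algebra structure on the finite-dimensional
   space A is a bilinear map A -> A -> A. *)

Definition is_derivation (K : fieldType) (A : vectType K)
    (mul : {bilinear A -> A -> A}) (D : 'End(A)) : Prop :=
  forall a b : A, D (mul a b) = mul (D a) b + mul a (D b).

Definition Der (K : fieldType) (A : vectType K)
    (mul : {bilinear A -> A -> A}) : set 'End(A) :=
  [set D | is_derivation mul D]%classic.

Section IDD.
Variables (K : fieldType) (n : nat).
Local Notation A := 'rV[K]_n.+1.

Definition idd_basis (i : 'I_n.+1) : A := delta_mx 0 i.
Local Notation e := idd_basis.

(* [inord k] is the index [k] as soon as [k <= n]. *)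
Definition idd_basis_mul (i j : 'I_n.+1) : A :=
  if (i + j <= n)%N then (i%:R / j.+1%:R) *: e (inord (i + j)) else 0.

Definition idd_mul (a b : A) : A :=
  \sum_i \sum_j (a 0 i * b 0 j) *: idd_basis_mul i j.

Fact idd_mul_is_bilinear : bilinear_for *:%R *:%R idd_mul.
Proof.
split=> [b k u v | a k u v] /=; rewrite /idd_mul scaler_sumr -big_split;
  apply: eq_bigr => i _; rewrite /= scaler_sumr -big_split;
  apply: eq_bigr => j _; rewrite /= !mxE scalerA -scalerDl; congr (_ *: _).
- by rewrite mulrDl mulrA.
- by rewrite mulrDr mulrCA.
Qed.

HB.instance Definition _ :=
  bilinear_isBilinear.Build K A A A *:%R *:%R idd_mul idd_mul_is_bilinear.

Lemma idd_mul_basis (i j : 'I_n.+1) : idd_mul (e i) (e j) = idd_basis_mul i j.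
Proof.
rewrite /idd_mul (bigD1 i) //= [X in _ + X]big1 => [|k ki].
  rewrite addr0 (bigD1 j) //= big1 => [|l lj]; last first.
    by rewrite !mxE (negbTE lj) andbF mulr0 scale0r.
  by rewrite !mxE !eqxx mulr1 scale1r addr0.
by apply: big1 => l _; rewrite !mxE (negbTE ki) andbF mul0r scale0r.
Qed.

(* The linear map whose value at the i-th basis vector is the i-th row of the
   matrix, see [idd_phi_basis]. *)
Definition idd_phi : 'End(A) :=
  linfun (mulmxr (\matrix_(i < n.+1) (i%:R *: e i))).

Lemma idd_phi_basis (i : 'I_n.+1) : idd_phi (e i) = i%:R *: e i.
Proof. by rewrite lfunE /= -rowE rowK. Qed.

End IDD.

(* Main.v *)
Require Import Defs.
From mathcomp Require Import all_boot all_order all_algebra.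
From mathcomp Require Import classical_sets reals complex.
Local Open Scope ring_scope.

(** The element [e_0] does all the work: right multiplication by [e_0] is the
    linear map [phi] itself ([idd_mul_e0r]), while left multiplication by [e_0]
    is zero ([idd_mul_e0l]).  In characteristic 0 the integers [0, .., n] are
    distinct scalars, so [phi] is diagonal with simple spectrum.

    Let [D] be a derivation.  From [e_0 * e_0 = 0] one gets
    [phi (D e_0) = 0], so [D e_0 = c e_0] for some scalar [c].  Expanding
    [D (a * e_0)] then gives [D (phi a) = phi (D a) + c (phi a)]; at [a = e_1]
    the [e_1]-coordinate of this identity reads [d = d + c], so [c = 0].  This
    is where [1 <= n] matters: for [n = 0] the product vanishes and every
    endomorphism is a derivation.  Hence [D] commutes with [phi], and so acts
    on each [e_i] by a scalar [d_i].  Finally [e_1 * e_j] is a nonzero multiple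
    of [e_(j+1)], whence [d_(j+1) = d_1 + d_j], and [d_i = i d_1] since
    [d_0 = c = 0]; that is, [D = d_1 phi].

    Conversely [phi] is the Euler derivation of the grading of the algebra in
    which [e_i] has degree [i]. *)

Set Implicit Arguments.
Unset Strict Implicit.
Unset Printing Implicit Defensive.
Import GRing.Theory.

Section Derivations.
Variables (K : fieldType) (n : nat).
Local Notation A := 'rV[K]_n.+1.
Local Notation e := (@idd_basis K n).
Local Notation phi := (idd_phi K n).
Local Notation "a ** b" := (@idd_mul K n a b) (at level 40).

Lemma idd_basisE (i k : 'I_n.+1) : e i 0 k = (k == i)%:R.
Proof. by rewrite mxE eqxx. Qed.

Lemma idd_phiE (a : A) (k : 'I_n.+1) : phi a 0 k = k%:R * a 0 k.
Proof.
rewrite {1}[a]row_sum_delta linear_sum summxE (bigD1 k) //= big1 => [|i ik].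
  by rewrite linearZ /= idd_phi_basis !mxE !eqxx mulr1 mulrC addr0.
by rewrite linearZ /= idd_phi_basis !mxE eq_sym (negbTE ik) andbF !mulr0.
Qed.

Lemma idd_mul_e0r (a : A) : a ** e ord0 = phi a.
Proof.
rewrite {2}[a]row_sum_delta linear_sum; apply: eq_bigr => i _ /=.
rewrite (bigD1 ord0) //= big1 => [|j j0]; last first.
  by rewrite idd_basisE (negbTE j0) mulr0 scale0r.
rewrite addr0 idd_basisE eqxx mulr1 linearZ /= idd_phi_basis.
by rewrite /idd_basis_mul addn0 -ltnS ltn_ord inord_val divr1.
Qed.

Lemma idd_mul_e0l (a : A) : e ord0 ** a = 0.
Proof.
rewrite /idd_mul big1 // => i _; apply: big1 => j _.
rewrite idd_basisE; case: eqP => [->|_]; last by rewrite mul0r scale0r.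
by rewrite /idd_basis_mul; case: ifP => _; rewrite ?mul0r ?scale0r scaler0.
Qed.

(** The product of two basis vectors is homogeneous for the grading in which
    [e_i] has degree [i]. *)
Lemma idd_phi_basis_mul (i j : 'I_n.+1) :
  phi (idd_basis_mul K i j) = (i + j)%:R *: idd_basis_mul K i j.
Proof.
rewrite /idd_basis_mul; case: ifP => ij; last by rewrite linear0 scaler0.
by rewrite linearZ /= idd_phi_basis inordK // !scalerA mulrC.
Qed.

Lemma idd_phi_derivation : is_derivation (@idd_mul K n) phi.
Proof.
move=> a b /=; rewrite /idd_mul linear_sum -big_split; apply: eq_bigr => i _ /=.
rewrite linear_sum -big_split; apply: eq_bigr => j _ /=.
rewrite linearZ /= idd_phi_basis_mul !idd_phiE scalerA -scalerDl natrD mulrDr.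
by congr ((_ + _) *: _); [rewrite mulrC mulrA | rewrite mulrC mulrCA].
Qed.

Lemma derivationZ (B : vectType K) (mul : {bilinear B -> B -> B}) c D :
  is_derivation mul D -> is_derivation mul (c *: D).
Proof.
by move=> derD a b; rewrite !scale_lfunE derD scalerDr linearZl_LR linearZr.
Qed.

Hypothesis char0 : [pchar K] =i pred0.

Let natr_eq0 (m : nat) : (m%:R == 0 :> K) = (m == 0).
Proof. by move/pcharf0P: char0. Qed.

Let natr_inj : injective (fun m : nat => m%:R : K).
Proof.
have inj_le p q : (p <= q)%N -> p%:R = q%:R :> K -> p = q.
  move=> pq /esym/eqP; rewrite -subr_eq0 -natrB // natr_eq0 => qp.
  by apply/eqP; rewrite eqn_leq pq.
move=> p q /= pq; case/orP: (leq_total p q) => [/inj_le|/inj_le] -> //.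
Qed.

(** The eigenvalues [0, .., n] of [phi] are simple in characteristic 0, so that
    its eigenspaces are the lines spanned by the basis vectors. *)
Lemma idd_phi_eigen (a : A) (i : 'I_n.+1) :
  phi a = i%:R *: a -> a = a 0 i *: e i.
Proof.
move=> phia; apply/rowP => k; rewrite [RHS]mxE idd_basisE.
case: (eqVneq k i) => [->|ki]; first by rewrite mulr1.
have /eqP := congr1 (fun v : A => v 0 k) phia.
rewrite idd_phiE [X in _ == X]mxE -subr_eq0 -mulrBl mulf_eq0 subr_eq0 mulr0.
case/orP => [/eqP/natr_inj/val_inj ik|/eqP-> //]; by rewrite ik eqxx in ki.
Qed.

Section OneDerivation.
Hypothesis n_gt0 : (1 <= n)%N.
Variable D : 'End(A).
Hypothesis derD : is_derivation (@idd_mul K n) D.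

Let e1 : 'I_n.+1 := inord 1.
Let e1E : e1 = 1%N :> nat. Proof. by rewrite inordK. Qed.

(** The argument is in two steps: [e_0 * e_0 = 0] forces [D e_0] to be a
    multiple of [e_0], and the identity [e_1 * e_0 = e_1] then forces that
    multiple to vanish. *)
Lemma derivation_e0 : D (e ord0) = 0.
Proof.
have De0 : D (e ord0) = D (e ord0) 0 ord0 *: e ord0.
  apply: idd_phi_eigen; rewrite scale0r -idd_mul_e0r.
  have /= := derD (e ord0) (e ord0).
  by rewrite !idd_mul_e0l linear0 addr0 => <-.
move: De0; set c := D _ 0 _ => De0; rewrite De0.
have /(congr1 (fun v : A => v 0 e1)) /= := derD (e e1) (e ord0).
rewrite De0 linearZr /= !idd_mul_e0r idd_phi_basis e1E scale1r.
rewrite [X in _ = X -> _]mxE [X in _ = _ + X -> _]mxE idd_phiE.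
rewrite idd_basisE eqxx e1E mul1r mulr1.
by rewrite -[LHS]addr0 => /addrI <-; rewrite scale0r.
Qed.

Lemma derivation_comm_phi (a : A) : D (phi a) = phi (D a).
Proof.
by rewrite -!idd_mul_e0r; have /= -> := derD a (e ord0);
  rewrite derivation_e0 linear0r addr0.
Qed.

Lemma derivation_diag (i : 'I_n.+1) : D (e i) = D (e i) 0 i *: e i.
Proof.
by apply: idd_phi_eigen; rewrite -derivation_comm_phi idd_phi_basis linearZ.
Qed.

(** The products [e_1 * e_j], which are nonzero multiples of [e_(j+1)], reach
    every basis vector from [e_0], so the eigenvalue of [D] on [e_m] grows by
    its value on [e_1] at each step. *)
Lemma derivation_eigenvalue (m : nat) :
  (m <= n)%N -> D (e (inord m)) = (m%:R * D (e e1) 0 e1) *: e (inord m).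
Proof.
elim: m => [_|m IHm m_lt_n].
  have -> : inord 0 = ord0 :> 'I_n.+1 by apply/val_inj; rewrite /= inordK.
  by rewrite derivation_e0 mul0r scale0r.
have e1em : e e1 ** e (inord m) = m.+1%:R^-1 *: e (inord m.+1).
  rewrite idd_mul_basis /idd_basis_mul e1E inordK; last exact: ltnW.
  by rewrite add1n m_lt_n mul1r.
have De1 := derivation_diag e1.
set d := D (e e1) 0 e1 in IHm De1 *.
have /= := derD (e e1) (e (inord m)).
rewrite IHm ?(ltnW m_lt_n) // De1 linearZl_LR linearZr /= e1em linearZ /=.
rewrite -scalerDl scalerA mulrC => /(congr1 ( *:%R m.+1%:R)).
rewrite !scalerA mulrA mulfV ?natr_eq0 // mul1r scale1r => ->.
by rewrite -[m.+1]add1n natrD mulrDl mul1r.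
Qed.

Lemma derivation_scalar_phi : D = D (e e1) 0 e1 *: phi.
Proof.
apply/lfunP => a; rewrite [a]row_sum_delta !linear_sum; apply: eq_bigr => i _.
rewrite !linearZ /= scale_lfunE; congr (_ *: _).
rewrite -/(e i) idd_phi_basis scalerA mulrC.
by have := @derivation_eigenvalue i; rewrite inord_val -ltnS; apply.
Qed.

End OneDerivation.

Theorem Der_idd (n_gt0 : (1 <= n)%N) (D : 'End(A)) :
  is_derivation (@idd_mul K n) D <-> D \in <[phi]>%VS.
Proof.
split=> [derD | /vlineP[c ->]].
  by apply/vlineP; exists (D (e (inord 1)) 0 (inord 1));
    apply: derivation_scalar_phi.
exact: derivationZ idd_phi_derivation.
Qed.

End Derivations.

Theorem theorem4p11 (R : realType) (n : nat) (hn : (1 <= n)%N) :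
  Der (@idd_mul R[i]%C n) =
  [set D : 'End('rV[R[i]%C]_n.+1) | D \in <[idd_phi R[i]%C n]>%VS]%classic.
Proof.
apply/seteqP; split=> D /=; have := Der_idd (Num.Theory.pchar_num R[i]%C) hn D.
  by case.
by case.
Qed.
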